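(* Let $p$ be an odd prime and let $L_p$ be the $p\times p$ matrix indexed by $0,\ldots,p-1$ with $(0,0)$ entry $3$, $(i,i)$ entry $2$ for $1\le i\le p-1$, entry $-1$ in positions $(i,j)$ with $j\equiv i\pm1\pmod p$, and $0$ elsewhere. Let $lCP_p=\{\lambda\in\mathbb{R}^p: L_p\lambda\ge0,\ \lambda_0=p\}$. Then there is an integer vector $w\in\mathbb{Z}^p$ with $w_0=p$ such that the polytope $\{(\mu_1,\ldots,\mu_{p-1})\in\mathbb{R}^{p-1}: (0,\mu_1,\ldots,\mu_{p-1})+w\in lCP_p\}$ is reflexive; that is, $lCP_p$ is reflexive after translation by an integral vector (viewed as a $(p-1)$-dimensional polytope in the hyperplane with lattice $\mathbb{Z}^{p-1}$).
   Context: $L_p$ is the Laplacian of the leafed $p$-cycle (the $p$-cycle on $0,\ldots,p-1$ with an extra leaf adjacent to $0$) with the row and column of the leaf deleted. A $d$-dimensional polytope $P\subset\mathbb{R}^d$ is reflexive if $0$ lies in its interior and both $P$ and its polar $P^\Delta=\{x\in\mathbb{R}^d: x\cdot y\le1\text{ for all }y\in P\}$ have all vertices in $\mathbb{Z}^d$. *)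

(* Defs.v *)
From HB Require Import structures.
From mathcomp Require Import all_boot all_order all_algebra.
From mathcomp Require Import all_classical all_reals all_analysis.
Set Implicit Arguments.
Unset Strict Implicit.
Unset Printing Implicit Defensive.
Import Order.TTheory GRing.Theory Num.Theory.
Import numFieldNormedType.Exports.
Local Open Scope classical_set_scope.
Local Open Scope ring_scope.

(* Points of R^d are column vectors 'cV[R]_d. *)

Definition dotp (R : realType) (d : nat) (x y : 'cV[R]_d) : R :=
  \sum_(i < d) x i 0 * y i 0.

(* Convex hull of the columns of V. *)
Definition conv_cols (R : realType) (d k : nat) (V : 'M[R]_(d, k)) :
    set 'cV[R]_d :=
  [set x | exists t : 'cV[R]_k,
    [/\ forall i, 0 <= t i 0, \sum_(i < k) t i 0 = 1 & x = V *m t]].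

Definition is_polytope (R : realType) (d : nat) (P : set 'cV[R]_d) : Prop :=
  exists (k : nat) (V : 'M[R]_(d, k)), P = conv_cols V.

(* {v} is a face of P, that is, v is the unique maximizer on P of some linear
   functional. *)
Definition is_vertex (R : realType) (d : nat) (P : set 'cV[R]_d)
    (v : 'cV[R]_d) : Prop :=
  P v /\ exists c : 'cV[R]_d, forall x, P x -> x != v -> dotp c x < dotp c v.

Definition polar (R : realType) (d : nat) (P : set 'cV[R]_d) : set 'cV[R]_d :=
  [set x | forall y, P y -> dotp x y <= 1].

Definition vertices_integral (R : realType) (d : nat) (P : set 'cV[R]_d) :
    Prop :=
  forall v, is_vertex P v -> v \is a mxOver Num.int.

(* Full-dimensionality of P in R^d is a consequence of P having an interior
   point. *)
Definition reflexive_polytope (R : realType) (d : nat) (P : set 'cV[R]_d) :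
    Prop :=
  [/\ is_polytope P, interior P 0,
      vertices_integral P & vertices_integral (polar P)].

(* Laplacian of the leafed p-cycle with the row and column of the leaf
   deleted (for p >= 3). *)
Definition leafed_cycle_mx (R : realType) (p : nat) : 'M[R]_p :=
  \matrix_(i < p, j < p)
    if i == j then (if (i : nat) == 0%N then 3 else 2)
    else if (j == i.+1 %[mod p])%N || (i == j.+1 %[mod p])%N then -1
    else 0.

(* For p >= 1 the dimension p.-1.+1 is p; writing it as a successor provides
   the index 0 and the decomposition R^p = R x R^(p-1). *)
Definition lCP (R : realType) (p : nat) : set 'cV[R]_p.-1.+1 :=
  [set lam | (forall i, 0 <= (leafed_cycle_mx R p.-1.+1 *m lam) i 0) /\
             lam 0 0 = p%:R].

(* The points mu of R^(p-1) such that (0, mu) + w lies in lCP. *)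
Definition translated_lCP (R : realType) (p : nat) (w : 'cV[int]_p.-1.+1) :
    set 'cV[R]_p.-1 :=
  [set mu | @lCP R p ((col_mx (0 : 'cV[R]_1) mu : 'cV[R]_p.-1.+1)
                   + map_mx (intr : int -> R) w)].

(* Main.v *)
(* Write L for the matrix and p = n + 1.  The all-ones row satisfies 1 L = e_0,
   so the coordinates of L lambda sum to lambda_0 = p and lCP is the simplex with
   vertices p L^-1 e_i, which are integral.  Its barycenter w = L^-1 1 is integral
   when p is odd, and after translation by -w the simplex is {A x >= -1}, where A
   consists of the last n columns of L.  A simplex {A x >= -1} = conv V with
   vertices summing to 0 and rows of A summing to 0 has polar conv (-A^T), so
   integrality of A and V gives reflexivity. *)
Require Import Defs.
From mathcomp Require Import all_boot all_order all_algebra.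
From mathcomp Require Import all_classical all_reals all_analysis.
From mathcomp Require Import zify ring.
Set Implicit Arguments.
Unset Strict Implicit.
Unset Printing Implicit Defensive.
Import Order.TTheory GRing.Theory Num.Theory.
Import numFieldNormedType.Exports.
Local Open Scope classical_set_scope.
Local Open Scope ring_scope.

(** * Polytopes: vertices, polars, and simplices given by inequalities *)

Section Polytopes.
Context {R : realType}.
Implicit Types d k : nat.

Lemma dotpE d (x y : 'cV[R]_d) : dotp x y = (x^T *m y) 0 0.
Proof. by rewrite mxE; apply: eq_bigr => i _; rewrite mxE. Qed.

Lemma dotp_mulmx d k (c : 'cV[R]_d) (V : 'M[R]_(d, k)) (t : 'cV[R]_k) :
  dotp c (V *m t) = \sum_i t i 0 * dotp c (col i V).
Proof.
rewrite dotpE mulmxA mxE; apply: eq_bigr => i _.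
by rewrite mulrC; congr (_ * _); rewrite dotpE colE mulmxA -colE [RHS]mxE.
Qed.

Lemma conv_cols_col d k (V : 'M[R]_(d, k)) (i : 'I_k) :
  conv_cols V (col i V).
Proof.
exists (delta_mx i 0); split; last by rewrite colE.
- by move=> j; rewrite mxE ler0n.
- rewrite (bigD1 i) //= mxE !eqxx big1 ?addr0 // => j /negbTE ji.
  by rewrite mxE ji.
Qed.

(** If [v] were no column, [c] would be strictly smaller at every column than at [v]; as [dotp c v]
    is a weighted mean of these values, all weights would vanish, yet they sum to 1. *)
Lemma vertex_conv_cols d k (V : 'M[R]_(d, k)) (v : 'cV[R]_d) :
  is_vertex (conv_cols V) v -> exists i, v = col i V.
Proof.
move=> [[t [t0 t1 vE]] [c cP]]; apply: contrapT => vV.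
have lt_cv i : dotp c (col i V) < dotp c v.
  apply: cP; first exact: conv_cols_col.
  by apply/eqP => iv; apply: vV; exists i.
have : \sum_i t i 0 * (dotp c v - dotp c (col i V)) = 0.
  under eq_bigr do rewrite mulrBr.
  by rewrite sumrB -mulr_suml t1 mul1r -dotp_mulmx -vE subrr.
move/eqP; rewrite psumr_eq0; last first.
  by move=> i _; rewrite mulr_ge0 // subr_ge0 ltW.
move/allP => all0; move: (oner_neq0 R); rewrite -t1 big1 ?eqxx // => i _.
have := all0 i (mem_index_enum i).
by rewrite mulf_eq0 subr_eq0 (gt_eqF (lt_cv i)) orbF => /eqP.
Qed.

Lemma vertices_integral_conv_cols d k (V : 'M[R]_(d, k)) :
  V \is a mxOver Num.int -> vertices_integral (conv_cols V).
Proof.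
move=> /mxOverP Vint v /vertex_conv_cols [i ->].
by apply/mxOverP => a b; rewrite mxE.
Qed.

Lemma polar_conv_cols d k (V : 'M[R]_(d, k)) :
  polar (conv_cols V) = [set x | forall i, (V^T *m x) i 0 <= 1].
Proof.
have colE' x i : dotp x (col i V) = (V^T *m x) i 0.
  by rewrite mxE; apply: eq_bigr => j _; rewrite !mxE mulrC.
apply/seteqP; split => x /= xP.
  by move=> i; rewrite -colE'; apply/xP/conv_cols_col.
move=> _ [t [t0 t1 ->]]; rewrite dotp_mulmx -t1.
by apply: ler_sum => i _; rewrite colE' -[leRHS]mulr1 ler_wpM2l.
Qed.

Lemma interior_halfspaces d k (A : 'M[R]_(k, d)) :
  interior [set x : 'cV[R]_d | forall i, -1 <= (A *m x) i 0] 0.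
Proof.
(* [S] dominates the absolute sum of each row, so [S^-1] is a suitable radius in the max norm; the
   summand 1 keeps it positive when [A] is zero. *)
pose S := 1 + \sum_i \sum_j `|A i j|.
have S0 : 0 < S.
  by rewrite ltr_wpDr // sumr_ge0 // => i _; rewrite sumr_ge0.
apply/nbhs_ballP; exists S^-1; first by rewrite /= invr_gt0.
move=> x [_ xball] i.
have xlt j : `|x j 0| <= S^-1.
  by have := xball j 0; rewrite mxE /ball /= sub0r normrN => /ltW.
have : `|(A *m x) i 0| <= 1.
  rewrite mxE (le_trans (ler_norm_sum _ _ _)) //.
  apply: (@le_trans _ _ (\sum_j `|A i j| * S^-1)).
    by apply: ler_sum => j _; rewrite normrM ler_wpM2l.
  rewrite -mulr_suml ler_pdivrMr // mul1r /S (bigD1 i) //= addrCA lerDl.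
  by rewrite addr_ge0 // sumr_ge0 // => a _; rewrite sumr_ge0.
by rewrite ler_norml => /andP[].
Qed.

(** The barycentric coordinates of [x] are [(A x + 1) / (k + 1)]: the inequalities make them
    nonnegative, [1 A = 0] makes them sum to 1, and [V] maps them back to [x]. Conversely,
    [A V t = (k + 1) t - 1] when [t] sums to 1. *)
Lemma halfspaces_conv_cols d k (A : 'M[R]_(k.+1, d)) (V : 'M[R]_(d, k.+1)) :
  V *m A = k.+1%:R%:M -> A *m V = k.+1%:R%:M - const_mx 1 ->
  V *m const_mx 1 = 0 :> 'cV_d -> const_mx 1 *m A = 0 :> 'rV_d ->
  [set x | forall i, -1 <= (A *m x) i 0] = conv_cols V.
Proof.
move=> VA AV V1 A1; have k0 : k.+1%:R != 0 :> R by rewrite pnatr_eq0.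
apply/seteqP; split => [x xP|_ [t [t0 t1 ->]] i].
- exists (k.+1%:R^-1 *: (A *m x + const_mx 1)); split.
  + by move=> i; rewrite !mxE mulr_ge0 // -lerBlDr sub0r; have := xP i; rewrite mxE.
  + have : (const_mx 1 *m (A *m x) : 'cV_1) 0 0 = 0.
      by rewrite mulmxA A1 mul0mx mxE.
    rewrite mxE; under eq_bigr do rewrite mxE mul1r; move=> sumAx.
    under eq_bigr do rewrite mxE mxE [X in _ + X]mxE.
    by rewrite -mulr_sumr big_split /= sumAx add0r sumr_const card_ord mulVf.
  + by rewrite -scalemxAr mulmxDr V1 addr0 mulmxA VA mul_scalar_mx scalerA mulVf ?scale1r.
- rewrite mulmxA AV mulmxBl mul_scalar_mx !mxE.
  under eq_bigr do rewrite mxE mul1r.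
  by rewrite t1 lerDr mulr_ge0.
Qed.

(* The hypotheses are self-dual under (A, V) |-> (-V^T, -A^T), which exchanges
   the simplex with its polar. *)
Lemma reflexive_simplex d k (A : 'M[R]_(k.+1, d)) (V : 'M[R]_(d, k.+1)) :
  V *m A = k.+1%:R%:M -> A *m V = k.+1%:R%:M - const_mx 1 ->
  V *m const_mx 1 = 0 :> 'cV_d -> const_mx 1 *m A = 0 :> 'rV_d ->
  A \is a mxOver Num.int -> V \is a mxOver Num.int ->
  reflexive_polytope [set x | forall i, -1 <= (A *m x) i 0].
Proof.
move=> VA AV V1 A1 Aint Vint.
have PE := halfspaces_conv_cols VA AV V1 A1.
have polarE : polar (conv_cols V) = conv_cols (- A^T).
  rewrite polar_conv_cols -(halfspaces_conv_cols (A := - V^T)).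
  - by apply/seteqP; split => x xP i; have := xP i;
      rewrite /= mulNmx [X in -1 <= X]mxE lerN2.
  - by rewrite mulNmx mulmxN opprK -trmx_mul VA tr_scalar_mx.
  - by rewrite mulNmx mulmxN opprK -trmx_mul AV linearB /= tr_scalar_mx trmx_const.
  - by rewrite mulNmx -[const_mx 1]trmx_const -trmx_mul A1 trmx0 oppr0.
  - by rewrite mulmxN -[const_mx 1]trmx_const -trmx_mul V1 trmx0 oppr0.
split.
- by exists k.+1, V.
- exact: interior_halfspaces.
- by rewrite PE; apply: vertices_integral_conv_cols.
- rewrite PE polarE; apply: vertices_integral_conv_cols.
  by apply/mxOverP => i j; rewrite !mxE rpredN; apply: (mxOverP Aint).
Qed.

End Polytopes.

(** * The reduced Laplacian as a cyclic second difference, and its integral solutions *)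

Section LeafedCycle.
Context {R : realType} {n : nat} (n_gt1 : (1 < n)%N).
Local Notation L := (leafed_cycle_mx R n.+1).

(** [n_gt1] makes [i], [ordS i] and [ord_pred i] pairwise distinct, so the nested tests of the
    definition turn into a sum of indicators, over which products distribute. *)
Lemma leafed_cycle_mxE (i j : 'I_n.+1) :
  L i j = (2 + (i == 0)%:R) * (j == i)%:R
          - (j == ordS i)%:R - (j == ord_pred i)%:R.
Proof.
have ES : (j == ordS i) = (j == i.+1 %[mod n.+1])%N.
  by rewrite -val_eqE /= (modn_small (ltn_ord j)).
have EP : (j == ord_pred i) = (i == j.+1 %[mod n.+1])%N.
  by rewrite -(inj_eq (can_inj (@ordSK _))) ord_predK eq_sym -val_eqE /=
    (modn_small (ltn_ord i)).
rewrite mxE -ES -EP eq_sym.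
have dSi : ordS i != i.
  apply/eqP => /(congr1 val) /=; have := ltn_ord i.
  rewrite leq_eqVlt eqSS => /orP[/eqP ->|lt]; first by rewrite modnn; lia.
  by rewrite modn_small //; lia.
have dSP : ordS i != ord_pred i.
  rewrite -(inj_eq (can_inj (@ordSK _))) ord_predK; apply/eqP => /(congr1 val) /=.
  have := ltn_ord i; rewrite leq_eqVlt eqSS => /orP[/eqP ->|lt].
    by rewrite modnn modn_small; lia.
  rewrite (modn_small lt); move: lt; rewrite leq_eqVlt => /orP[/eqP lt|lt].
    by rewrite [i.+2]lt modnn => i0; move: lt n_gt1; rewrite -i0 => -[<-].
  by rewrite modn_small // => /eqP; rewrite eqn_leq ltnNge leqnSn.
have dPi : ord_pred i != i.
  by rewrite -(inj_eq (can_inj (@ordSK _))) ord_predK eq_sym.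
case: (eqVneq j i) => [->|ji] /=.
  rewrite (eq_sym i (ordS i)) (negbTE dSi) (eq_sym i (ord_pred i)) (negbTE dPi).
  rewrite -val_eqE /= mulr1 !subr0.
  by case: ifP => _; rewrite ?addr0 // -natrD.
rewrite mulr0 sub0r; case: (eqVneq j (ordS i)) => [->|_] /=.
  by rewrite (negbTE dSP) subr0.
by case: (j == _); rewrite ?oppr0 ?add0r ?oppr0.
Qed.

Lemma leafed_cycle_mulmx m (x : 'M[R]_(n.+1, m)) i l :
  (L *m x) i l = (2 + (i == 0)%:R) * x i l - x (ordS i) l - x (ord_pred i) l.
Proof.
rewrite mxE; under eq_bigr do rewrite leafed_cycle_mxE !mulrBl -mulrA.
have delta a : \sum_j (j == a)%:R * x j l = x a l.
  rewrite (bigD1 a) //= eqxx mul1r big1 ?addr0 // => j /negbTE ->.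
  by rewrite mul0r.
by rewrite !sumrB -mulr_sumr !delta.
Qed.

Lemma leafed_cycle_tr : L^T = L.
Proof. by apply/matrixP => i j; rewrite !mxE orbC eq_sym; case: eqP => // ->. Qed.

(** By symmetry of [L], apply it to a constant column: the differences cancel and only the extra
    unit at 0 remains. *)
Lemma ones_leafed_cycle : const_mx 1 *m L = delta_mx 0 0 :> 'rV_n.+1.
Proof.
apply: trmx_inj; rewrite trmx_mul leafed_cycle_tr trmx_const trmx_delta.
apply/matrixP => i j; rewrite leafed_cycle_mulmx !mxE ord1 eqxx andbT; ring.
Qed.

(** Unrolls the cycle into the sequence on [0, ..., n + 1] with equal ends, so that modular
    successors disappear. *)
Lemma leafed_cycle_mulmx_fun m (f : nat -> 'I_m -> R) i l :
  f n.+1 l = f 0 l ->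
  (L *m \matrix_(j, l) f j l) i l =
  if i == 0 then 3 * f 0 l - f 1%N l - f n l
  else 2 * f i l - f i.+1 l - f i.-1 l.
Proof.
move=> fp; rewrite leafed_cycle_mulmx !mxE /=.
case: eqVneq => [-> /=|i0].
  by rewrite !modn_small ?ltnS ?(ltnW n_gt1) //; ring.
have i_gt0 : (0 < i)%N by rewrite lt0n.
have -> : ((i + n.+1).-1 %% n.+1)%N = i.-1.
  have -> : ((i + n.+1).-1 = i.-1 + n.+1)%N by lia.
  by rewrite modnDr modn_small //; have := ltn_ord i; lia.
rewrite addr0; congr (_ - _ - _).
have := ltn_ord i; rewrite leq_eqVlt => /orP[/eqP ->|lt]; first by rewrite modnn fp.
by rewrite modn_small.
Qed.

(* Column i is the vertex L^-1 (p e_i): the sequence on 0, ..., p that equals p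
   at both ends and is linear except for its slope dropping by p at i (for i = 0
   it is constant). *)
Definition cycle_vertices : 'M[int]_n.+1 :=
  \matrix_(j, i) (n.+1 + minn j i * (n.+1 - maxn j i))%:Z.

(* The barycenter L^-1 (1, ..., 1), whose slope drops by 1 at 1, ..., p - 1;
   the halving is exact because j (p - j) is even for odd p. *)
Definition cycle_center : 'cV[int]_n.+1 :=
  \col_j (n.+1 + (j * (n.+1 - j))./2)%:Z.

Lemma leafed_cycle_vertices :
  L *m map_mx intr cycle_vertices = n.+1%:R%:M.
Proof.
pose f j (i : 'I_n.+1) : R := (n.+1 + minn j i * (n.+1 - maxn j i))%:R.
have -> : map_mx intr cycle_vertices = \matrix_(j, i) f j i.
  by apply/matrixP => i j; rewrite !mxE.
(* The two linear pieces on either side of the kink at [l]; both are valid at [j = l]. *)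
have f_le j (l : 'I_n.+1) : (j <= l)%N ->
    f j l = n.+1%:R + j%:R * (n.+1%:R - l%:R).
  by move=> le_jl; rewrite /f (minn_idPl le_jl) (maxn_idPr le_jl)
    natrD natrM natrB // ltnW.
have f_ge j (l : 'I_n.+1) : (l <= j <= n.+1)%N ->
    f j l = n.+1%:R + l%:R * (n.+1%:R - j%:R).
  by move=> /andP[le_lj le_jn]; rewrite /f (minn_idPr le_lj) (maxn_idPl le_lj)
    natrD natrM natrB.
have pE : n.+1%:R = n%:R + 1 :> R by rewrite natr1.
apply/matrixP => i l; have ltl := ltn_ord l; have lti := ltn_ord i.
rewrite leafed_cycle_mulmx_fun; last first.
  by rewrite (f_ge n.+1) ?leqnn ?andbT 1?ltnW // f_le //; ring.
rewrite mxE; have [i0|i0] := eqVneq i 0.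
  rewrite i0 eq_sym; have [->|l0] := eqVneq l 0.
    by rewrite !f_ge /= ?leqnSn // mulr1n; ring.
  (* With [p = n + 1], the neighbours 1 and [n] of 0 carry [p + (p - l)] and [p + l], which add up
     to [3 p]. *)
  rewrite (f_le 0%N) // (f_le 1%N) ?lt0n // (f_ge n) ?leqnSn ?andbT -1?ltnS //.
  by rewrite [RHS]mulr0n pE; ring.
have {}i0 : (0 < i)%N by rewrite lt0n.
have iE : i%:R = i.-1%:R + 1 :> R by rewrite natr1 prednK.
have iSE : i.+1%:R = i.-1%:R + 1 + 1 :> R by rewrite -iE natr1.
have [h|h|h] := ltngtP i l.
- rewrite -val_eqE /= (ltn_eqF h) mulr0n !f_le //; [|lia..].
  by rewrite iSE iE; ring.
- rewrite -val_eqE /= (gtn_eqF h) mulr0n !f_ge //; [|lia..].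
  by rewrite iSE iE; ring.
- rewrite -val_eqE /= h eqxx mulr1n (f_ge l.+1) ?f_le //; [|lia..].
  by rewrite -h iSE iE; ring.
Qed.

(** With [p = n + 1], the second difference of [j (p - j) / 2] is -1; at 0 both neighbours carry
    [p + n / 2], leaving [3 p - 2 p - n = 1]. *)
Lemma leafed_cycle_center : ~~ odd n ->
  L *m map_mx intr cycle_center = const_mx 1.
Proof.
move=> n_even.
pose f j (i : 'I_1) : R := (n.+1 + (j * (n.+1 - j))./2)%:R.
have -> : map_mx intr cycle_center = \matrix_(j, i) f j i.
  by apply/matrixP => i j; rewrite !mxE.
have fE j i : (j <= n.+1)%N ->
    f j i = n.+1%:R + j%:R * (n.+1%:R - j%:R) / 2.
  move=> lej; rewrite /f natrD; congr (_ + _); rewrite -natrB // -natrM.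
  have even_j : ~~ odd (j * (n.+1 - j)).
    by rewrite oddM oddB //= (negbTE n_even) /=; case: odd.
  by rewrite -[in RHS](even_halfK even_j) -muln2 natrM mulfK ?pnatr_eq0.
apply/matrixP => i l; have lti := ltn_ord i.
rewrite leafed_cycle_mulmx_fun; last by rewrite !fE //; field.
rewrite mxE; case: eqVneq => [_|i0].
  by rewrite !fE //; field.
have {}i0 : (0 < i)%N by rewrite lt0n.
rewrite !fE; [|lia..].
have iE : i%:R = i.-1%:R + 1 :> R by rewrite natr1 prednK.
by rewrite -[i.+1%:R]natr1 iE; field.
Qed.

End LeafedCycle.

(** * Reflexivity of the translated simplex *)

Theorem theorem6p3 (R : realType) (p : nat) (p_prime : prime p)
    (p_odd : odd p) :
  exists w : 'cV[int]_p.-1.+1,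
    w 0 0 = p%:Z /\ reflexive_polytope (@translated_lCP R p w).
Proof.
have p_gt2 := odd_prime_gt2 p_odd p_prime.
case: p p_odd p_gt2 {p_prime} => // n /= n_even n_gt1.
exists (cycle_center (n := n)).
split; first by rewrite mxE /= addn0.
pose L : 'M[R]_(n.+1, 1 + n) := leafed_cycle_mx R n.+1.
pose w : 'cV[R]_(1 + n) := map_mx intr (cycle_center (n := n)).
pose K : 'M[R]_(1 + n, n.+1) := map_mx intr (cycle_vertices (n := n)).
have LK : L *m K = n.+1%:R%:M := leafed_cycle_vertices n_gt1.
have Lw : L *m w = const_mx 1 := leafed_cycle_center n_gt1 n_even.
have KL : K *m L = n.+1%:R%:M.
  have p0 : n.+1%:R != 0 :> R by rewrite pnatr_eq0.
  have : (n.+1%:R^-1 *: L) *m K = 1%:M.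
    by rewrite -scalemxAl LK scale_scalar_mx mulVf.
  by move/mulmx1C; rewrite -scalemxAr => /(canRL (scalerKV p0)) ->;
    rewrite scale_scalar_mx mulr1.
have oneL : const_mx 1 *m L = delta_mx 0 0 :> 'rV_(1 + n) := ones_leafed_cycle n_gt1.
(* The vertices translated by [-w]. Row 0 vanishes since [K] and [w] both have entries [p] there, so
   [dsubmx K'] loses nothing. *)
pose K' := K - w *m const_mx 1.
have uK' : usubmx K' = 0.
  apply/matrixP => i j; rewrite !mxE big_ord1 !mxE /= ord1 /=.
  by rewrite min0n mul0n mulr1 subrr.
have K'E : K' = col_mx 0 (dsubmx K') by rewrite -uK' vsubmxK.
have LE : L = row_mx (lsubmx L) (rsubmx L) by rewrite hsubmxK.
(* Since [L w = 1], each inequality of the cone shifts to a bound by -1; the condition on coordinate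
   0 holds automatically. *)
have -> : @translated_lCP R n.+1 (cycle_center (n := n)) =
    [set x | forall i, -1 <= (rsubmx L *m x) i 0].
  have eqAx (x : 'cV_n) i : (L *m (col_mx 0 x + w)) i 0 = (rsubmx L *m x) i 0 + 1.
    by rewrite mulmxDr Lw LE mul_row_col mulmx0 add0r row_mxKr mxE [const_mx _ _ _]mxE.
  apply/seteqP; split => x /=.
    by move=> [xP _] i; have := xP i; rewrite eqAx -lerBlDr sub0r.
  move=> xP; split; first by move=> i; rewrite eqAx -lerBlDr sub0r.
  by rewrite !mxE; case: splitP => // k _; rewrite mxE add0r /= addn0.
apply: (@reflexive_simplex R n n (rsubmx L) (dsubmx K')).
(* [K' L = p I - w e_0^T], and the second term only touches column 0, which lies outside this
   block. *)
- have -> : dsubmx K' *m rsubmx L = drsubmx (K' *m L).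
    by rewrite K'E {2}LE mul_col_row block_mxKdr -K'E.
  rewrite mulmxBl KL -mulmxA oneL.
  apply/matrixP => i j; rewrite !mxE big_ord1 !mxE.
  by rewrite -[rshift 1 j == 0]/false andbF mulr0 subr0 (inj_eq (@rshift_inj 1 n)).
- have -> : rsubmx L *m dsubmx K' = L *m K'.
    by rewrite {2}LE {2}K'E mul_row_col mulmx0 add0r.
  rewrite mulmxBr LK mulmxA Lw; congr (_ - _).
  by apply/matrixP => i j; rewrite !mxE big_ord1 !mxE mulr1.
- rewrite mul_dsub_mx.
  have -> : K' *m const_mx 1 = 0 :> 'cV_(1 + n); last by rewrite linear0.
  (* The vertices sum to [K 1 = K L w = p w], so [w] is their barycenter. *)
  rewrite mulmxBl -Lw mulmxA KL mul_scalar_mx Lw -mulmxA.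
  apply/matrixP => i j; rewrite !mxE big_ord1 !mxE ord1.
  under eq_bigr do rewrite !mxE mulr1.
  by rewrite sumr_const card_ord mulrC subrr.
- rewrite mulmx_rsub oneL.
  by apply/matrixP => i j; rewrite !mxE -[rshift 1 j == _]/false andbF.
- apply/mxOverP => i j; rewrite !mxE.
  by do 2![case: ifP => _]; rewrite ?rpredN ?rpred0 ?rpred1 // rpred_nat.
- apply/mxOverP => i j; rewrite !mxE big_ord1 !mxE mulr1.
  by rewrite rpredB // intr_int.
Qed.
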